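(* Let $q\colon (G,\mathcal{P})\to(H,\mathcal{Q})$ be a quasi-isometry of group pairs and let $\dot q\colon \mathcal{K}(G,\mathcal{P})\to\mathcal{K}(H,\mathcal{Q})$ be an induced map. Then: (1) The induced map $\dot q$ is a simplicial map and a homotopy equivalence. (2) All choices of $\dot q$ are homotopic as continuous maps $\mathcal{K}(G,\mathcal{P})\to\mathcal{K}(H,\mathcal{Q})$. (3) The induced map $\dot q\colon\mathcal{K}(G,\mathcal{P})\to\mathcal{K}(H,\mathcal{Q})$ is a quasi-isometry of simplicial complexes.
   Context: A group pair $(G,\mathcal{P})$ is a finitely generated group $G$ together with a finite collection $\mathcal{P}$ of infinite subgroups of $G$. $G$ carries a fixed word metric $\mathrm{dist}_G$ with respect to a finite generating set, and $\mathrm{hdist}_G$ denotes the Hausdorff distance (possibly $\infty$) between subsets of $G$. $G/\mathcal{P}$ denotes the set of all left cosets $gP$ with $g\in G$, $P\in\mathcal{P}$. An $(L,C,M)$-quasi-isometry of group pairs $q\colon(G,\mathcal{P})\to(H,\mathcal{Q})$ (with $L\ge1$, $C\ge0$, $M>0$) is an $(L,C)$-quasi-isometry $q\colon(G,\mathrm{dist}_G)\to(H,\mathrm{dist}_H)$ such that for every $A\in G/\mathcal{P}$ there is $B\in H/\mathcal{Q}$ with $\mathrm{hdist}_H(q(A),B)<M$, and for every $B\in H/\mathcal{Q}$ there is $A\in G/\mathcal{P}$ with $\mathrm{hdist}_H(q(A),B)<M$. A quasi-isometry of group pairs is an $(L,C,M)$-quasi-isometry of group pairs for some $L,C,M$.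 An induced map $\dot q$ is any function $\dot q\colon G/\mathcal{P}\to H/\mathcal{Q}$ such that $\mathrm{hdist}_H(\dot q(A),q(A))\le M$ for every $A\in G/\mathcal{P}$, where $M$ is such a constant for $q$. The coset intersection complex $\mathcal{K}(G,\mathcal{P})$ is the simplicial complex with vertex set $G/\mathcal{P}$ in which a finite set $\{g_1P_1,\dots,g_kP_k\}\subset G/\mathcal{P}$ spans a simplex if and only if $\bigcap_{i=1}^k g_iP_ig_i^{-1}$ is an infinite subgroup of $G$. A simplicial map is a function between vertex sets such that the images of the vertices of any simplex span a simplex; it induces a continuous map of geometric realizations (with the weak topology). In (3), the complexes carry the length metric of a piecewise Euclidean complex all of whose simplices are regular Euclidean simplices with unit edge lengths; it is an extended metric (points in different components are at distance $\infty$). A function $f\colon X\to Y$ of extended metric spaces is a quasi-isometry if there are $L\ge1,C\ge0$ such that for all $a,b\in X$: $\mathrm{dist}_X(a,b)=\infty$ iff $\mathrm{dist}_Y(f(a),f(b))=\infty$; if $\mathrm{dist}_X(a,b)<\infty$ then $\frac1L\mathrm{dist}_X(a,b)-C\le\mathrm{dist}_Y(f(a),f(b))\le L\,\mathrm{dist}_X(a,b)+C$; and every $y\in Y$ is within distance $C$ of some $f(x)$. *)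

(* Defs.v *)
From HB Require Import structures.
From mathcomp Require Import all_boot all_order all_algebra finmap.
From mathcomp Require Import boolp classical_sets functions cardinality.
From mathcomp Require Import reals constructive_ereal ereal topology normedtype.
Set Implicit Arguments.
Unset Strict Implicit.
Unset Printing Implicit Defensive.
Import Order.TTheory GRing.Theory Num.Theory.
Import numFieldNormedType.Exports.
Local Open Scope classical_set_scope.
Local Open Scope ring_scope.

Section CoarseGeometry.
Variable R : realType.

(* For distances that are everywhere finite the first conjunct is automatic and
   this is the usual notion of an (L, C)-quasi-isometry. *)
Definition quasi_isometry_with (L C : R) (X Y : Type)
    (dX : X -> X -> \bar R) (dY : Y -> Y -> \bar R) (f : X -> Y) : Prop :=
  [/\ forall a b, dX a b = +oo%E <-> dY (f a) (f b) = +oo%E,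
      forall a b, (dX a b < +oo)%E ->
        ((L^-1)%:E * dX a b - C%:E <= dY (f a) (f b))%E /\
        (dY (f a) (f b) <= L%:E * dX a b + C%:E)%E &
      forall y, exists x, (dY y (f x) <= C%:E)%E].

Definition quasi_isometry (X Y : Type)
    (dX : X -> X -> \bar R) (dY : Y -> Y -> \bar R) (f : X -> Y) : Prop :=
  exists L C : R, [/\ 1 <= L, 0 <= C & quasi_isometry_with L C dX dY f].

Definition hdist (X : Type) (d : X -> X -> \bar R) (A B : set X) : \bar R :=
  ereal_inf [set r%:E | r in [set r : R | [/\ 0 <= r,
    forall a, A a -> exists2 b, B b & (d a b <= r%:E)%E &
    forall b, B b -> exists2 a, A a & (d a b <= r%:E)%E]]].

End CoarseGeometry.

Section Groups.
Local Open Scope group_scope.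

Definition word_over (G : groupType) (S : {fset G}) (w : seq G) : bool :=
  all (fun x => (x \in S) || (x^-1 \in S)) w.

Definition generates (G : groupType) (S : {fset G}) : Prop :=
  forall g : G, exists2 w : seq G, word_over S w & g = \prod_(x <- w) x.

(* The generating set is part of the data: it is the one whose word metric the
   group carries. *)
Record group_pair := GroupPair {
  gp_group :> groupType;
  gp_gens : {fset gp_group};
  gp_generates : generates gp_gens;
  gp_subgroups : set (set gp_group);
  gp_finite : finite_set gp_subgroups;
  gp_closed : forall P, gp_subgroups P -> group_closed [in P];
  gp_infinite : forall P, gp_subgroups P -> infinite_set P }.
Global Arguments gp_gens : clear implicits.
Global Arguments gp_subgroups : clear implicits.

(* The left-invariant word metric: left translations are isometries and permute
   the left cosets. *)
Definition word_dist (R : realType) (X : group_pair) (g h : X) : \bar R :=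
  ereal_inf [set ((size w)%:R : R)%:E | w in
    [set w : seq X | word_over (gp_gens X) w /\ g^-1 * h = \prod_(x <- w) x]].

Definition lcoset_set (G : groupType) (g : G) (P : set G) : set G :=
  [set g * x | x in P].

Definition conj_set (G : groupType) (g : G) (P : set G) : set G :=
  [set g * x * g^-1 | x in P].

Definition left_cosets (X : group_pair) : set (set X) :=
  [set A | exists g P, gp_subgroups X P /\ A = lcoset_set g P].
Global Arguments left_cosets : clear implicits.

Definition coset (X : group_pair) : choiceType := set_type (left_cosets X).

(* g P g^-1 for the coset A = g P; independent of the way A is written, see
   coset_conjE. *)
Definition coset_conj (X : group_pair) (A : coset X) : set X :=
  [set x | exists g P,
    [/\ gp_subgroups X P, val A = lcoset_set g P & conj_set g P x]].

End Groups.

Record simplicial_complex (V : choiceType) := SimplicialComplex {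
  simplex : set {fset V};
  simplex_neq0 : forall s, simplex s -> s != fset0;
  simplex1 : forall v : V, simplex [fset v]%fset;
  simplexS : forall s t : {fset V},
    simplex s -> (t `<=` s)%fset -> t != fset0 -> simplex t }.

Definition simplicial (V W : choiceType) (K : simplicial_complex V)
    (L : simplicial_complex W) (f : V -> W) : Prop :=
  forall s, simplex K s -> simplex L [fset f v | v in s]%fset.

Section CosetIntersectionComplex.
Variable X : group_pair.
Local Open Scope group_scope.

Lemma conj_set_eq (g h : X) (P Q : set X) :
  gp_subgroups X P -> gp_subgroups X Q ->
  lcoset_set g P = lcoset_set h Q -> conj_set g P = conj_set h Q.
Proof.
have sub (g1 g2 : X) (P1 P2 : set X) : gp_subgroups X P1 -> gp_subgroups X P2 ->
    lcoset_set g1 P1 = lcoset_set g2 P2 -> conj_set g1 P1 `<=` conj_set g2 P2.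
  move=> sP1 sP2 E _ [x P1x <-].
  have [P11 _] := gp_closed sP1; have [P21 P2div] := gp_closed sP2.
  have [y /mem_set P2y yE] : lcoset_set g2 P2 (g1 * x).
    by rewrite -E; exists x.
  have [z /mem_set P2z zE] : lcoset_set g2 P2 g1.
    by rewrite -E; exists 1; [exact/set_mem|rewrite mulg1].
  exists (y / z); first by apply/set_mem; exact: P2div.
  by rewrite -yE -zE invgM !mulgA.
by move=> sP sQ E; apply/seteqP; split; apply: sub.
Qed.

Lemma coset_conjE (A : coset X) (g : X) (P : set X) :
  gp_subgroups X P -> val A = lcoset_set g P -> coset_conj A = conj_set g P.
Proof.
move=> sP E; apply/seteqP; split=> [x [h [Q [sQ E' Qx]]]|x Px]; last first.
  by exists g, P.
by rewrite (conj_set_eq sP sQ (etrans (esym E) E')).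
Qed.

Definition coset_simplex : set {fset coset X} :=
  [set s | s != fset0 /\ infinite_set (\bigcap_(A in [set` s]) coset_conj A)].

Lemma coset_simplex_neq0 s : coset_simplex s -> s != fset0.
Proof. by case. Qed.

Lemma coset_simplex1 (A : coset X) : coset_simplex [fset A]%fset.
Proof.
split; first by apply/fset0Pn; exists A; rewrite inE.
have /set_mem [g [P [sP E]]] := valP A.
rewrite (_ : \bigcap_(_ in _) _ = conj_set g P); last first.
  apply/seteqP; split=> x.
    by move=> /(_ A); rewrite (coset_conjE sP E); apply; rewrite /= inE.
  by move=> Px B; rewrite /= inE => /eqP ->; rewrite (coset_conjE sP E).
move=> fin; apply: (gp_infinite sP).
have -> : P = [set g^-1 * x * g | x in conj_set g P].
  apply/seteqP; split=> [x Px|_ [_ [x Px <-] <-]].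
    exists (g * x * g^-1); first by exists x.
    by rewrite !mulgA mulVg mul1g -mulgA mulVg mulg1.
  by rewrite !mulgA mulVg mul1g -mulgA mulVg mulg1.
exact: finite_image.
Qed.

Lemma coset_simplexS (s t : {fset coset X}) :
  coset_simplex s -> (t `<=` s)%fset -> t != fset0 -> coset_simplex t.
Proof.
move=> [_ infs] /fsubsetP ts t0; split=> // fint; apply: infs.
by apply: sub_finite_set fint => x Ix A tA; apply: Ix; exact: ts.
Qed.

Definition coset_complex : simplicial_complex (coset X) :=
  SimplicialComplex coset_simplex_neq0 coset_simplex1 coset_simplexS.

End CosetIntersectionComplex.

Section Realization.
Variables (R : realType) (V : choiceType) (K : simplicial_complex V).

(* Barycentric coordinates. *)
Definition realization : Type :=
  set_type [set t : {fsfun V -> R with 0} |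
    [/\ forall v, 0 <= t v,
        simplex K (finsupp t) &
        \sum_(v <- finsupp t) t v = 1]].

HB.instance Definition _ := Choice.on realization.

Definition coord (t : realization) : {fsfun V -> R with 0} := val t.

Definition in_simplex (s : {fset V}) (t : realization) : bool :=
  (finsupp (coord t) `<=` s)%fset.

(* Weak topology: U is open iff its trace on each closed simplex is open for the
   Euclidean topology, here expressed with the sup distance of coordinates. *)
Definition realization_open (U : set realization) : Prop :=
  forall s, simplex K s -> forall t, in_simplex s t -> U t ->
  exists2 e : R, 0 < e &
    forall t', in_simplex s t' ->
      (forall v, v \in s -> `|coord t v - coord t' v| < e) -> U t'.

Let openT : realization_open setT.
Proof. by move=> s _ t _ _; exists 1. Qed.

Let openI (A B : set realization) :
  realization_open A -> realization_open B -> realization_open (A `&` B).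
Proof.
move=> oA oB s Ks t ts [At Bt].
have [e1 e1_gt0 He1] := oA s Ks t ts At; have [e2 e2_gt0 He2] := oB s Ks t ts Bt.
exists (Num.min e1 e2) => [|t' t's near]; first by rewrite lt_min e1_gt0.
by split; [apply: He1|apply: He2] => // v /near; rewrite lt_min => /andP[].
Qed.

Let open_bigcup (I : Type) (f : I -> set realization) :
  (forall i, realization_open (f i)) -> realization_open (\bigcup_i f i).
Proof.
move=> of_ s Ks t ts [i _ fit]; have [e e0 He] := of_ i s Ks t ts fit.
by exists e => // t' t's near; exists i => //; exact: He.
Qed.

HB.instance Definition _ :=
  isOpenTopological.Build realization openT openI open_bigcup.

(* Distance inside a simplex of the affine regular simplex with unit edges:
   the vertices sit at e_v / sqrt 2 in the Euclidean space with basis (e_v). *)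
Definition simplex_dist (x y : realization) : R :=
  Num.sqrt (2^-1 * \sum_(v <- (finsupp (coord x) `|` finsupp (coord y))%fset)
                      (coord x v - coord y v) ^+ 2).

(* A string from x to y: consecutive points lie in a common closed simplex. *)
Definition is_string (n : nat) (p : nat -> realization) (x y : realization) :=
  [/\ p 0%N = x, p n = y &
      forall i, (i < n)%N -> exists s,
        [/\ simplex K s, in_simplex s (p i) & in_simplex s (p i.+1)]].

(* The length metric of the piecewise Euclidean complex: infimum of the lengths
   of strings, +oo if there is none. *)
Definition length_dist (x y : realization) : \bar R :=
  ereal_inf [set l%:E | l in [set l : R | exists n p,
    is_string n p x y /\ l = \sum_(i < n) simplex_dist (p i) (p i.+1)]].

End Realization.

Section RealizationMap.
Variables (R : realType) (V W : choiceType).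
Variables (K : simplicial_complex V) (L : simplicial_complex W).
Variables (f : V -> W) (fS : simplicial K L f).
Local Notation "|K|" := (realization R K).

Definition push (t : {fsfun V -> R with 0}) : {fsfun W -> R with 0} :=
  [fsfun w in [fset f v | v in finsupp t]%fset =>
     \sum_(v <- finsupp t | f v == w) t v].

Lemma pushE t w : push t w = \sum_(v <- finsupp t | f v == w) t v.
Proof.
rewrite fsfunE; case: ifPn => // wf; rewrite big_seq_cond big_pred0 // => v.
apply/negbTE; apply: contra wf => /andP[vt /eqP <-].
by apply/imfsetP; exists v.
Qed.

Lemma push_realization (t : |K|) :
  [/\ forall w, 0 <= push (coord t) w,
      simplex L (finsupp (push (coord t))) &
      \sum_(w <- finsupp (push (coord t))) push (coord t) w = 1].
Proof.
have /set_mem [t_ge0 Kt t1] := valP t; rewrite -/(coord t) in t_ge0 Kt t1.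
have sub : (finsupp (push (coord t)) `<=` [fset f v | v in finsupp (coord t)])%fset.
  by apply/fsubsetP => w; rewrite mem_finsupp fsfunE; case: ifP => //; rewrite eqxx.
have sum1 : \sum_(w <- finsupp (push (coord t))) push (coord t) w = 1.
  rewrite -[RHS]t1 (big_fset_incl _ sub) /=; last first.
    by move=> w _; rewrite mem_finsupp negbK => /eqP.
  under eq_bigr do rewrite pushE.
  rewrite (exchange_big_dep xpredT) //= big_seq [RHS]big_seq.
  apply: eq_bigr => v vt.
  rewrite big_mkcond (bigD1_seq (f v)) ?fset_uniq //=; last by apply/imfsetP; exists v.
  by rewrite eqxx big1 ?addr0 // => w /negPf; rewrite eq_sym => ->.
split=> // [w|]; first by rewrite pushE; apply: sumr_ge0.
apply: simplexS (fS Kt) sub _; apply: contraPneq sum1 => ->.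
by rewrite big_seq_fset0 => /eqP; rewrite eq_sym oner_eq0.
Qed.

(* The map induced by f on realizations: affine on every simplex. *)
Definition realize (t : |K|) : realization R L :=
  SigSub (mem_set (push_realization t)).

End RealizationMap.

Section Homotopy.
Variables (R : realType) (X Y : topologicalType).

Definition homotopic (f g : X -> Y) : Prop :=
  exists h : X * R -> Y,
    [/\ {within [set xt | 0 <= xt.2 <= 1], continuous h},
        forall x, h (x, 0) = f x & forall x, h (x, 1) = g x].

End Homotopy.

Definition homotopy_equivalence (R : realType) (X Y : topologicalType)
    (f : X -> Y) : Prop :=
  continuous f /\ exists g : Y -> X,
    [/\ continuous g, homotopic R (g \o f) id & homotopic R (f \o g) id].

Section GroupPairs.
Variables (R : realType) (X Y : group_pair).

Definition pair_quasi_isometry_with (L C M : R) (q : X -> Y) : Prop :=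
  [/\ [/\ 1 <= L, 0 <= C & 0 < M],
      quasi_isometry_with L C (@word_dist R X) (@word_dist R Y) q,
      forall A, left_cosets X A -> exists2 B, left_cosets Y B &
        (hdist (@word_dist R Y) (q @` A) B < M%:E)%E &
      forall B, left_cosets Y B -> exists2 A, left_cosets X A &
        (hdist (@word_dist R Y) (q @` A) B < M%:E)%E].

Definition pair_quasi_isometry (q : X -> Y) : Prop :=
  exists L C M, pair_quasi_isometry_with L C M q.

Definition induced_map (q : X -> Y) (qd : coset X -> coset Y) : Prop :=
  exists L C M, pair_quasi_isometry_with L C M q /\
    forall A : coset X,
      (hdist (@word_dist R Y) (val (qd A)) (q @` val A) <= M%:E)%E.

End GroupPairs.

(* Main.v *)
(** Cosets A_1, ..., A_k span a simplex exactly when some common r-neighbourhood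
    of all of them is infinite: one direction is [x g \in g P] for
    [x \in g P g^-1], the other is the pigeonhole principle on the balls of the
    word metric. This criterion is visibly invariant under coarse embeddings, so
    an induced map is simplicial, two maps induced by close quasi-isometries are
    contiguous, and an inverse up to contiguity is induced by a quasi-inverse of
    q. Contiguous maps are homotopic along straight lines.

    The complexes may be infinite-dimensional, in which case their length metric
    need not be quasi-isometric to the 1-skeleton, and a simplicial map need not be
    coarsely Lipschitz. What saves (3) is that the fibres of an induced map are
    uniformly finite, of size at most N say: its realization is then
    sqrt N-Lipschitz on every simplex. The same holds for the inverse, and a
    point lies in a common simplex, hence within distance 1, with its image under
    either composite. *)
From mathcomp Require Import all_boot all_order all_algebra finmap.
From mathcomp Require Import boolp classical_sets functions cardinality.
From mathcomp Require Import zify ring lra.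
From mathcomp Require Import reals constructive_ereal ereal topology normedtype.
Require Import Defs.
Set Implicit Arguments.
Unset Strict Implicit.
Unset Printing Implicit Defensive.
Import Order.TTheory GRing.Theory Num.Theory.
Import numFieldNormedType.Exports.
Local Open Scope classical_set_scope.
Local Open Scope ring_scope.

(** * Word metrics and coset simplices *)

Section WordMetric.
Variable X : group_pair.
Local Open Scope group_scope.

Definition word_ball (n : nat) : set X :=
  [set \prod_(x <- w) x | w in
    [set w : seq X | word_over (gp_gens X) w /\ (size w <= n)%N]].

(** The word metric at integer scale, free of [R]: coarse constants become natural numbers that add
    along chains of points. *)
Definition word_near (n : nat) (x y : X) : Prop := word_ball n (x^-1 * y).

Lemma word_ball0 : word_ball 0 = [set 1].
Proof.
apply/seteqP; split=> [_ [w [_ +] <-]|_ ->].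
  by rewrite leqn0 size_eq0 => /eqP ->; rewrite big_nil.
by exists [::]; rewrite ?big_nil.
Qed.

Lemma word_ballW m n : (m <= n)%N -> word_ball m `<=` word_ball n.
Proof.
by move=> mn _ [w [ww wm] <-]; exists w => //; split=> //; exact: leq_trans mn.
Qed.

Lemma word_ballM m n x y :
  word_ball m x -> word_ball n y -> word_ball (m + n) (x * y).
Proof.
move=> [v [vS vm] <-] [w [wS wn] <-]; exists (v ++ w); last by rewrite big_cat.
by split; [rewrite /word_over all_cat; apply/andP|rewrite size_cat leq_add].
Qed.

Lemma word_ballV n x : word_ball n x -> word_ball n x^-1.
Proof.
move=> [w [ww wn] <-]; exists [seq a^-1 | a <- rev w]; last first.
  elim: w {ww wn} => [|a w IHw]; first by rewrite !big_nil invg1.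
  by rewrite rev_cons map_rcons -cats1 big_cat big_seq1 /= IHw big_cons invgM.
split; last by rewrite size_map size_rev.
rewrite /word_over all_map all_rev; apply: sub_all ww => a /=.
by rewrite invgK orbC.
Qed.

Lemma finite_word_ball n : finite_set (word_ball n).
Proof.
elim: n => [|n IHn]; first by rewrite word_ball0; exact: finite_set1.
pose letters : set X :=
  [set` gp_gens X] `|` [set x^-1 | x in [set` gp_gens X]].
have fin_letters : finite_set letters.
  by rewrite finite_setU; split; [|apply: finite_image]; exact: finite_fset.
apply: (@sub_finite_set _ _
  (word_ball n `|` [set x * y | x in letters & y in word_ball n])).
  move=> _ [[|a w] [ww wn] <-].
    by left; exists [::].
  right; exists a; last exists (\prod_(x <- w) x); last by rewrite big_cons.
    move: ww => /= /andP[/orP[aS|aS] _]; first by left.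
    by right; exists a^-1; rewrite ?invgK.
  by exists w => //; split=> //; move: ww => /= /andP[].
by rewrite finite_setU; split=> //; exact: finite_image2.
Qed.

Lemma word_nearxx n x : word_near n x x.
Proof. by rewrite /word_near mulVg; exists [::]; rewrite ?big_nil. Qed.

Lemma word_nearW m n x y : (m <= n)%N -> word_near m x y -> word_near n x y.
Proof. by move=> mn; exact: word_ballW. Qed.

Lemma word_nearC n x y : word_near n x y -> word_near n y x.
Proof. by move=> /word_ballV; rewrite invgM invgK. Qed.

Lemma word_near_trans m n y x z :
  word_near m x y -> word_near n y z -> word_near (m + n) x z.
Proof.
by move=> xy yz; have := word_ballM xy yz; rewrite mulgA -(mulgA _ y) mulgV mulg1.
Qed.

Lemma finite_word_near n x : finite_set [set y | word_near n x y].
Proof.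
apply: sub_finite_set (finite_image ( *%g x) (finite_word_ball n)) => y xy.
by exists (x^-1 * y) => //; rewrite mulgA mulgV mul1g.
Qed.

Lemma word_near_dist (R : realType) n (x y : X) :
  word_near n x y -> (word_dist R x y <= n%:R%:E)%E.
Proof.
move=> [w [ww wn] wE]; apply: (@le_trans _ _ ((size w)%:R : R)%:E).
  by apply: ereal_inf_lbound; exists w.
by rewrite lee_fin ler_nat.
Qed.

Lemma dist_word_near (R : realType) (r : R) :
  exists n, forall x y : X, (word_dist R x y <= r%:E)%E -> word_near n x y.
Proof.
(* Adding 1 makes the comparison with the infimum strict, so that an actual word can be extracted;
   the absolute value covers negative radii. *)
exists (Num.truncn (`|r| + 1)%R) => x y xyr.
have : (word_dist R x y < (`|r| + 1)%:E)%E.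
  apply: le_lt_trans xyr _; rewrite lte_fin.
  by apply: le_lt_trans (ler_norm r) _; rewrite ltrDl.
move=> /ereal_inf_lt [_ [w [ww wE] <-]]; rewrite lte_fin => wr.
exists w => //; split=> //.
by rewrite truncn_ge_nat ?ltW// addr_ge0.
Qed.

Lemma word_dist_lt_oo (R : realType) (x y : X) : (word_dist R x y < +oo)%E.
Proof.
have [w ww wE] := @gp_generates X (x^-1 * y).
apply: (@le_lt_trans _ _ ((size w)%:R : R)%:E); last exact: ltry.
by apply: ereal_inf_lbound; exists w.
Qed.

End WordMetric.

Section CosetSimplices.
Variable X : group_pair.
Local Open Scope group_scope.

Lemma coset_inP (A : coset X) :
  exists g P, gp_subgroups X P /\ val A = lcoset_set g P.
Proof. by have /set_mem := valP A. Qed.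

Lemma coset_nonempty (A : coset X) : exists a, val A a.
Proof.
have [g [P [sP ->]]] := coset_inP A; exists (g * 1); exists 1 => //.
by apply/set_mem; case: (gp_closed sP).
Qed.

(** The factor [u] cancels in [(x * u) * (y * u)^-1], and the quotient of [g p] by [g p'] is
    [g (p p'^-1) g^-1]. *)
Lemma coset_conj_div (A : coset X) (x y u : X) :
  val A (x * u) -> val A (y * u) -> coset_conj A (x * y^-1).
Proof.
have [g [P [sP AE]]] := coset_inP A; rewrite (coset_conjE sP AE) AE.
have [_ Pdiv] := gp_closed sP.
move=> [p /mem_set Pp pE] [p' /mem_set Pp' p'E].
exists (p / p'); first by apply/set_mem; exact: Pdiv.
have -> : x * y^-1 = (x * u) * (y * u)^-1.
  by rewrite invgM !mulgA -(mulgA x u) mulgV mulg1.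
by rewrite -pE -p'E invgM !mulgA.
Qed.

(** Right multiplication by [g] sends [g p g^-1] to [g p], so the length of a word for [g] is a
    radius valid for all [p] at once. *)
Lemma coset_conj_near (A : coset X) :
  exists n, forall x, coset_conj A x -> exists2 a, val A a & word_near n x a.
Proof.
have [g [P [sP AE]]] := coset_inP A; rewrite (coset_conjE sP AE) AE.
have [w ww wE] := @gp_generates X g.
exists (size w) => _ [p Pp <-]; exists (g * p); first by exists p.
exists w => //; rewrite -wE !invgM !invgK !mulgA -(mulgA _ g^-1) mulVg mulg1.
by rewrite -(mulgA _ p^-1) mulVg mulg1.
Qed.

Lemma infinite_fiber (T U : Type) (f : T -> U) (I : set T) (B : set U) :
  finite_set B -> infinite_set I -> (forall x, I x -> B (f x)) ->
  exists2 u, B u & infinite_set (I `&` f @^-1` [set u]).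
Proof.
move=> finB infI IB; apply: contrapT => nex; apply: infI.
apply: (@sub_finite_set _ _ (\bigcup_(u in B) (I `&` f @^-1` [set u]))).
  by move=> x Ix; exists (f x) => //; exact: IB.
apply: bigcup_finite => // u Bu; apply: contrapT => infu.
by apply: nex; exists u.
Qed.

(* Pigeonhole: for infinitely many x the same u_A of length at most n satisfies
   x u_A \in A, and for two such points x y^-1 lies in the conjugate of A. *)
Lemma infinite_conj (n : nat) (s : seq (coset X)) (I : set X) :
  infinite_set I ->
  (forall x, I x -> forall A, A \in s -> exists2 a, val A a & word_near n x a) ->
  exists I', [/\ I' `<=` I, infinite_set I' & forall x y, I' x -> I' y ->
    forall A, A \in s -> coset_conj A (x * y^-1)].
Proof.
elim: s => [|A s IHs] infI near_s.
  by exists I; split=> // x y _ _ A; rewrite in_nil.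
have [|I' [I'I infI' I's]] := IHs infI.
  by move=> x Ix B Bs; apply: near_s => //; rewrite inE Bs orbT.
have near_A (x : X) : exists u, I' x -> word_ball n u /\ val A (x * u).
  have [I'x|] := pselect (I' x); last by exists 1.
  have [a Aa xa] := near_s _ (I'I _ I'x) A (mem_head _ _).
  by exists (x^-1 * a) => _; rewrite mulgA mulgV mul1g.
pose u x := projT1 (cid (near_A x)).
have uP x : I' x -> word_ball n (u x) /\ val A (x * u x).
  exact: projT2 (cid (near_A x)).
have [|v _ infv] := @infinite_fiber _ _ u _ _ (@finite_word_ball X n) infI'.
  by move=> x /uP[].
exists (I' `&` u @^-1` [set v]); split=> //.
  by move=> x [/I'I].
move=> x y [I'x /= xv] [I'y /= yv] B; rewrite inE => /predU1P[->|]; last exact: I's.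
have [_ Ax] := uP _ I'x; have [_ Ay] := uP _ I'y.
by apply: (@coset_conj_div _ _ _ v); [rewrite -[v]xv|rewrite -[v]yv].
Qed.

Lemma coset_simplexP (s : {fset coset X}) :
  simplex (coset_complex X) s <-> s != fset0 /\ exists n, infinite_set
    [set x | forall A, A \in s -> exists2 a, val A a & word_near n x a].
Proof.
split=> -[s0].
  move=> inf_s; split=> //.
  pose n A := projT1 (cid (coset_conj_near A)).
  have nP A := projT2 (cid (coset_conj_near A)).
  exists (\max_(A <- s) n A)%N; apply: contra_not inf_s.
  apply: sub_finite_set => x sx A As; have [a Aa xa] := nP A x (sx A As).
  by exists a => //; apply: word_nearW xa; rewrite leq_bigmax_seq.
move=> [n inf_s]; split=> //.
have [I [_ infI Is]] := infinite_conj inf_s (fun x Ix => Ix).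
have [y Iy] : exists y, I y.
  apply: contrapT => nI; apply: infI; rewrite (_ : I = set0) //.
  by apply/seteqP; split=> // x Ix; case: nI; exists x.
(* For a fixed [y] in [I], the right translate by [y] of the intersection of the conjugates contains
   [I]. *)
apply: contra_not infI => fin_conj.
apply: (@sub_finite_set _ _ [set z * y | z in
  \bigcap_(A in [set` s]) coset_conj A]); last exact: finite_image.
move=> x Ix; exists (x * y^-1); last by rewrite -mulgA mulVg mulg1.
by move=> A As; exact: Is.
Qed.

End CosetSimplices.

(** * Coarse embeddings and the coset maps that follow them *)

Definition contiguous (V W : choiceType) (K : simplicial_complex V)
    (L : simplicial_complex W) (f g : V -> W) : Prop :=
  forall s, simplex K s ->
    simplex L ([fset f v | v in s] `|` [fset g v | v in s])%fset.

(** Counting duplicate-free lists gives finiteness of the fibres and the uniform bound together. *)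
Definition fibers_bounded (N : nat) (V W : choiceType) (f : V -> W) : Prop :=
  forall w (s : seq V), uniq s -> (forall v, v \in s -> f v = w) ->
    (size s <= N)%N.

Definition coarse_embedding (X Y : group_pair) (phi : X -> Y) : Prop :=
  (forall n, exists m, forall x x',
     word_near n x x' -> word_near m (phi x) (phi x')) /\
  (forall n, exists m, forall x x',
     word_near n (phi x) (phi x') -> word_near m x x').

Definition tracks (X Y : group_pair) (phi : X -> Y)
    (f : coset X -> coset Y) : Prop :=
  exists n, forall A : coset X,
    (forall a, val A a -> exists2 b, val (f A) b & word_near n (phi a) b) /\
    (forall b, val (f A) b -> exists2 a, val A a & word_near n (phi a) b).

Definition close (X Y : group_pair) (phi psi : X -> Y) : Prop :=
  exists n, forall x, word_near n (phi x) (psi x).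

Lemma coarse_embedding_comp (X Y Z : group_pair) (phi : X -> Y) (psi : Y -> Z) :
  coarse_embedding phi -> coarse_embedding psi -> coarse_embedding (psi \o phi).
Proof.
move=> [phi1 phi2] [psi1 psi2]; split=> n.
  have [m mP] := phi1 n; have [k kP] := psi1 m.
  by exists k => x x' /mP/kP.
have [m mP] := psi2 n; have [k kP] := phi2 m.
by exists k => x x' /mP/kP.
Qed.

(** Points with the same image are uniformly near each other, so fibres lie in finite balls; an
    infinite set with finite image would have an infinite fibre. *)
Lemma coarse_embedding_infinite (X Y : group_pair) (phi : X -> Y) (I : set X) :
  coarse_embedding phi -> infinite_set I -> infinite_set (phi @` I).
Proof.
move=> [_ /(_ 0%N)[m mP]] infI finI.
have [|y _ infy] := infinite_fiber finI infI (f := phi); first by move=> x; exists x.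
have [x [Ix xy]] : (I `&` phi @^-1` [set y]) !=set0.
  by apply/set0P; apply: contra_not_neq infy => ->.
apply: infy; apply: sub_finite_set (finite_word_near m x) => x' [_ x'y].
by apply: mP; rewrite (xy : phi x = y) (x'y : phi x' = y); exact: word_nearxx.
Qed.

Lemma contiguous_close (X Y : group_pair) (phi psi : X -> Y)
    (f g : coset X -> coset Y) :
  coarse_embedding phi -> close phi psi -> tracks phi f -> tracks psi g ->
  contiguous (coset_complex X) (coset_complex Y) f g.
Proof.
move=> phiC [k kP] [m mP] [n nP] s /coset_simplexP[/fset0Pn[A0 A0s] [r infs]].
have [r' r'P] := phiC.1 r.
apply/coset_simplexP; split.
  by apply/fset0Pn; exists (f A0); rewrite inE in_imfset.
(* One radius for both kinds of vertices: [r' + m] reaches [f A] from [phi x], and [r' + (k + n)]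
   reaches [g A] by passing from [phi a] to [psi a]. *)
exists (r' + (k + (k + (m + n))))%N.
apply: contra_not (coarse_embedding_infinite phiC infs).
apply: sub_finite_set => _ [x sx <-] B; rewrite inE.
case/orP=> /imfsetP[A /= As ->{B}]; have [a Aa /r'P xa] := sx A As.
  have [b fAb ab] := (mP A).1 a Aa; exists b => //.
  by apply: (word_nearW _ (word_near_trans xa ab)); lia.
have [b gAb ab] := (nP A).1 a Aa; exists b => //.
apply: (word_nearW _ (word_near_trans xa (word_near_trans (kP a) ab))); lia.
Qed.

Lemma tracks_simplicial (X Y : group_pair) (phi : X -> Y)
    (f : coset X -> coset Y) :
  coarse_embedding phi -> tracks phi f ->
  simplicial (coset_complex X) (coset_complex Y) f.
Proof.
move=> phiC phif s Ks.
have closexx : close phi phi by exists 0%N => x; exact: word_nearxx.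
by have := contiguous_close phiC closexx phif phif Ks; rewrite fsetUid.
Qed.

Lemma tracks_id (X : group_pair) : tracks (@id X) id.
Proof.
by exists 0%N => A; split=> a Aa; exists a => //; exact: word_nearxx.
Qed.

Lemma tracks_comp (X Y Z : group_pair) (phi : X -> Y) (psi : Y -> Z)
    (f : coset X -> coset Y) (g : coset Y -> coset Z) :
  coarse_embedding psi -> tracks phi f -> tracks psi g ->
  tracks (psi \o phi) (g \o f).
Proof.
move=> psiC [m mP] [n nP]; have [k kP] := psiC.1 m.
exists (k + n)%N => A; split=> [a Aa|c gfAc].
  have [b fAb /kP ab] := (mP A).1 a Aa; have [c gfAc bc] := (nP (f A)).1 b fAb.
  by exists c => //; exact: word_near_trans bc.
have [b fAb bc] := (nP (f A)).2 c gfAc; have [a Aa /kP ab] := (mP A).2 b fAb.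
by exists a => //; exact: word_near_trans bc.
Qed.

Lemma lcoset_setM (X : group_pair) (g a : X) (P : set X) :
  gp_subgroups X P -> lcoset_set g P a -> lcoset_set g P = lcoset_set a P.
Proof.
move=> sP [p /mem_set Pp <-]; have [P1 Pdiv] := gp_closed sP.
have PV x : x \in P -> (x^-1)%g \in P.
  by move=> Px; have := Pdiv _ _ P1 Px; rewrite mul1g.
have PM x y : x \in P -> y \in P -> (x * y)%g \in P.
  by move=> Px Py; rewrite -[y]invgK; apply: Pdiv => //; exact: PV.
apply/seteqP; split=> _ [x /mem_set Px <-].
  exists (p^-1 * x)%g; last by rewrite -mulgA (mulgA p) mulgV mul1g.
  by apply/set_mem/PM => //; exact: PV.
by exists (p * x)%g; [exact/set_mem/PM|rewrite mulgA].
Qed.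

(* The cosets of one fibre all meet a common ball, and a coset is determined by
   its subgroup and any one of its points. *)
Lemma tracks_fibers_bounded (X Y : group_pair) (phi : X -> Y)
    (f : coset X -> coset Y) :
  coarse_embedding phi -> tracks phi f -> exists N, fibers_bounded N f.
Proof.
(* Points whose images are both within [n] of the same [b] have images within [n + n] of each other,
   hence lie within [m]. *)
move=> [_ phiV] [n nP]; have [m mP] := phiV (n + n)%N.
have /finite_seqP[ball ballE] := @finite_word_ball X m.
have /finite_seqP[subg subgE] := @gp_finite X.
exists (size ball * size subg)%N => B s s_uniq sB.
have [->//|[A0 A0s]] : s = [::] \/ exists A0, A0 \in s.
  by case: s {s_uniq sB} => [|A0 s]; [left|right; exists A0; exact: mem_head].
have [b Bb] := coset_nonempty B.
have near_b A : A \in s -> exists2 a, val A a & word_near n (phi a) b.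
  by move=> /sB AB; apply: (nP A).2; rewrite AB.
have [a0 A0a0 a0b] := near_b _ A0s.
(* Every coset of the fibre has the form [a0 u P] with [u] in the ball of radius [m] and [P] among
   the finitely many subgroups. *)
rewrite -(size_map val) -(size_allpairs (fun u P => lcoset_set (a0 * u)%g P)).
apply: uniq_leq_size; first by rewrite map_inj_uniq//; exact: val_inj.
move=> _ /mapP[A /near_b[a Aa ab] ->].
have [g [P [sP AE]]] := coset_inP A.
apply/allpairsP; exists ((a0^-1 * a)%g, P); split => /=.
- suff : [set` ball] (a0^-1 * a)%g by [].
  by rewrite -ballE; apply: mP; apply: word_near_trans a0b (word_nearC ab).
- by suff : [set` subg] P by []; rewrite -subgE.
rewrite mulgA mulgV mul1g AE; apply: lcoset_setM => //.
by rewrite -AE.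
Qed.

(** * Quasi-isometries of group pairs as coarse embeddings, and their quasi-inverses *)

Section QuasiIsometries.
Variables (R : realType) (X Y : group_pair) (q : X -> Y).

Lemma hdist_lt (T : Type) (d : T -> T -> \bar R) (A B : set T) (M : R) :
  (hdist d A B < M%:E)%E ->
  (forall a, A a -> exists2 b, B b & (d a b <= M%:E)%E) /\
  (forall b, B b -> exists2 a, A a & (d a b <= M%:E)%E).
Proof.
move=> /ereal_inf_lt[_ [r [_ rA rB] <-]]; rewrite lte_fin => /ltW rM.
by split=> [a /rA[b Bb ab]|b /rB[a Aa ab]]; [exists b|exists a] => //;
  rewrite (le_trans ab)// lee_fin.
Qed.

Lemma quasi_isometry_coarse (L C M : R) : pair_quasi_isometry_with L C M q ->
  coarse_embedding q /\ exists k, forall y, exists x, word_near k y (q x).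
Proof.
move=> [[L1 C0 _] [_ qd qs] _ _].
have L0 : 0 < L by exact: lt_le_trans L1.
split; first split=> n.
- have [m mP] := dist_word_near Y (L * n%:R + C).
  exists m => x x' xx'; apply: mP.
  have [_ le_q] := qd _ _ (word_dist_lt_oo R x x').
  apply: (le_trans le_q); rewrite EFinD EFinM leeD2r// lee_pmul2l//.
  exact: word_near_dist.
- have [m mP] := dist_word_near X (L * (n%:R + C)).
  exists m => x x' /(word_near_dist R) xx'; apply: mP.
  have lt_oo := word_dist_lt_oo R x x'; have [ge_q _] := qd _ _ lt_oo.
  have := le_trans ge_q xx'.
  rewrite leeBlDr// -EFinD.
  by rewrite lee_pdivrMl.
have [k kP] := dist_word_near Y C.
by exists k => y; have [x yx] := qs y; exists x; exact: kP.
Qed.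

Lemma induced_map_tracks qd : induced_map R q qd -> tracks q qd.
Proof.
(* The bound [M] need not be attained by an admissible radius; [M + 1] exceeds the infimum
   strictly. *)
move=> [_ [_ [M [_ qdM]]]]; have [n nP] := dist_word_near Y (M + 1).
exists n => A; have [|BA AB] := @hdist_lt _ (@word_dist R Y)
  (val (qd A)) (q @` val A) (M + 1).
  by apply: le_lt_trans (qdM A) _; rewrite lte_fin ltrDl.
split=> [a Aa|b /BA[_ [a Aa <-] /nP ba]].
  have [|b Bb /nP ba] := AB (q a); first by exists a.
  by exists b => //; exact: word_nearC.
by exists a => //; exact: word_nearC.
Qed.

(** Coarse surjectivity of [q] provides [psi], and the clause on cosets of [Y] provides [g]. These
    independent choices fit together: for [b] in [B], [q (psi b)] is near [b], which is near [q a]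
    for some [a] in [g B], and nearness pulls back along [q]. *)
Lemma coarse_inverse : pair_quasi_isometry R q ->
  exists (psi : Y -> X) (g : coset Y -> coset X),
    [/\ coarse_embedding psi, tracks psi g, close (psi \o q) id &
        close (q \o psi) id].
Proof.
move=> [L [C [M qLCM]]]; have [[q1 q2] [k kP]] := quasi_isometry_coarse qLCM.
pose psi y := projT1 (cid (kP y)).
have psiP y : word_near k y (q (psi y)) := projT2 (cid (kP y)).
have [n nP] := dist_word_near Y M.
have exg (B : coset Y) : exists A : coset X,
    (forall a, val A a -> exists2 b, val B b & word_near n (q a) b) /\
    (forall b, val B b -> exists2 a, val A a & word_near n (q a) b).
  have [_ _ _ qB] := qLCM; have [A XA /hdist_lt[AB BA]] := qB _ (set_mem (valP B)).
  exists (SigSub (mem_set XA)); split=> [a Aa|b /BA[_ [a Aa <-] /nP ab]].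
    by have [|b Bb /nP ab] := AB (q a); [exists a|exists b].
  by exists a.
pose g B := projT1 (cid (exg B)).
have gP B := projT2 (cid (exg B)).
exists psi, g; split.
- split=> m.
    have [m' m'P] := q2 (k + (m + k))%N; exists m' => y y' yy'; apply: m'P.
    apply: word_near_trans (word_nearC (psiP y)) _.
    exact: word_near_trans yy' (psiP y').
  have [m' m'P] := q1 m; exists (k + (m' + k))%N => y y' /m'P yy'.
  apply: word_near_trans (psiP y) _.
  exact: word_near_trans yy' (word_nearC (psiP y')).
- have [m mP] := q2 (k + n)%N; exists m => B.
  split=> [b /(gP B).2[a Aa ab]|a /(gP B).1[b Bb ab]].
    exists a => //; apply: mP.
    exact: word_near_trans (word_nearC (psiP b)) (word_nearC ab).
  exists b => //; apply: mP.
  exact: word_near_trans (word_nearC (psiP b)) (word_nearC ab).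
- by have [m mP] := q2 k; exists m => x; apply: mP; exact: word_nearC.
- by exists k => y; exact: word_nearC.
Qed.

End QuasiIsometries.

(** * Barycentric coordinates and contiguous maps *)

Section Coordinates.
Variables (R : realType) (V : choiceType) (K : simplicial_complex V).
Implicit Types (x y : realization R K) (s : {fset V}).

Lemma coord_ge0 x v : 0 <= coord x v.
Proof. by have /set_mem[] := valP x. Qed.

Lemma simplex_finsupp x : simplex K (finsupp (coord x)).
Proof. by have /set_mem[] := valP x. Qed.

Lemma coord_out s x v : in_simplex s x -> v \notin s -> coord x v = 0.
Proof.
by move=> /fsubsetP xs vs; apply: fsfun_dflt; apply: contra vs; exact: xs.
Qed.

Lemma sum_coord s x : in_simplex s x -> \sum_(v <- s) coord x v = 1.
Proof.
move=> xs; have /set_mem[_ _ <-] := valP x.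
by apply/esym/big_fset_incl => // v _ /fsfun_dflt.
Qed.

Lemma coord_le1 x v : coord x v <= 1.
Proof.
have xx : in_simplex (finsupp (coord x)) x by exact: fsubset_refl.
have [vx|/(coord_out xx) ->] := boolP (v \in finsupp (coord x)); last exact: ler01.
rewrite -(sum_coord xx) (big_fsetD1 v)//= lerDl.
by apply: sumr_ge0 => u _; exact: coord_ge0.
Qed.

Lemma coord_inj x y : coord x =1 coord y -> x = y.
Proof. by move=> /fsfunP xy; exact: val_inj. Qed.

Lemma realization_openE (U : set (realization R K)) :
  open U = realization_open U.
Proof. by []. Qed.

Definition seg_coord (c : R) x y : {fsfun V -> R with 0} :=
  [fsfun v in (finsupp (coord x) `|` finsupp (coord y))%fset =>
     (1 - c) * coord x v + c * coord y v].

Lemma seg_coordE c x y v :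
  seg_coord c x y v = (1 - c) * coord x v + c * coord y v.
Proof.
rewrite fsfunE inE; case: ifPn => //; rewrite negb_or => /andP[vx vy].
by rewrite /coord !fsfun_dflt// !mulr0 addr0.
Qed.

Lemma seg_coord_realization (c : R) x y s : simplex K s ->
  in_simplex s x -> in_simplex s y -> 0 <= c <= 1 ->
  [/\ forall v, 0 <= seg_coord c x y v, simplex K (finsupp (seg_coord c x y)) &
      \sum_(v <- finsupp (seg_coord c x y)) seg_coord c x y v = 1].
Proof.
move=> Ks xs ys /andP[c0 c1].
have sub : (finsupp (seg_coord c x y) `<=` s)%fset.
  apply: fsubset_trans (finsupp_sub _ _ _) _.
  by rewrite fsubUset; apply/andP; split.
have sum1 : \sum_(v <- finsupp (seg_coord c x y)) seg_coord c x y v = 1.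
  rewrite (big_fset_incl _ sub) /=; last by move=> v _ /fsfun_dflt.
  under eq_bigr do rewrite seg_coordE.
  by rewrite big_split/= -!mulr_sumr !sum_coord// !mulr1 subrK.
split=> // [v|].
  by rewrite seg_coordE addr_ge0// mulr_ge0 ?subr_ge0 ?coord_ge0.
apply: simplexS Ks sub _; apply: contraPneq sum1 => ->.
by rewrite big_seq_fset0 => /eqP; rewrite eq_sym oner_eq0.
Qed.

End Coordinates.

Section Pushforward.
Variables (R : realType) (V W : choiceType).
Variables (K : simplicial_complex V) (L : simplicial_complex W).
Implicit Types (x y : realization R K) (s : {fset V}) (f g : V -> W).

(** Replacing the support of [x] by any finite set containing it lets two points of one simplex be
    compared term by term. *)
Lemma push_sum f s x w : in_simplex s x ->
  push f (coord x) w = \sum_(v <- s | f v == w) coord x v.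
Proof.
move=> xs; rewrite pushE big_mkcond [RHS]big_mkcond /=.
by apply: big_fset_incl => // v _ /fsfun_dflt; rewrite /coord => ->; case: ifP.
Qed.

Lemma in_simplex_realize f (fS : simplicial K L f) s x : in_simplex s x ->
  in_simplex [fset f v | v in s]%fset (realize fS x).
Proof.
move=> /fsubsetP xs; apply: fsubset_trans (finsupp_sub _ _ _) _.
by apply/fsubsetP => _ /imfsetP[v /= /xs vs ->]; rewrite in_imfset.
Qed.

(** The constant grows with the simplex, which is harmless for continuity because the weak topology
    is tested one simplex at a time. *)
Lemma push_lipschitz f s x y e w : in_simplex s x -> in_simplex s y ->
  (forall v, v \in s -> `|coord x v - coord y v| <= e) ->
  `|push f (coord x) w - push f (coord y) w| <= #|` s|%:R * e.
Proof.
move=> xs ys xye; rewrite (push_sum _ _ xs) (push_sum _ _ ys) -sumrB.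
apply: le_trans (ler_norm_sum _ _ _) _.
apply: (@le_trans _ _ (\sum_(v <- s) `|coord x v - coord y v|)).
  by rewrite big_mkcond; apply: ler_sum => v _; case: ifP.
rewrite big_seq; apply: le_trans (ler_sum _ xye) _.
by rewrite -big_seq big_const_seq count_predT iter_addr_0 mulr_natl.
Qed.

Lemma continuous_realize f (fS : simplicial K L f) :
  continuous (realize (R := R) fS).
Proof.
apply/continuousP => U; rewrite !realization_openE => oU s Ks x xs Ux.
have [e e0 eU] := oU _ (fS _ Ks) _ (in_simplex_realize fS xs) Ux.
have n0 : 0 < #|` s|.+1%:R :> R by rewrite ltr0n.
(* The successor makes the Lipschitz bound on [s] strictly less than [e]. *)
exists (e / #|` s|.+1%:R); first exact: divr_gt0.
move=> y ys xy; apply: (eU _ (in_simplex_realize fS ys)) => w _.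
apply: (le_lt_trans (push_lipschitz _ _ xs ys (fun v vs => ltW (xy v vs)))).
by rewrite mulrCA gtr_pMr// ltr_pdivrMr// mul1r ltr_nat.
Qed.

Lemma realize_contiguous f g (fS : simplicial K L f) (gS : simplicial K L g)
    s x : in_simplex s x ->
  let t := ([fset f v | v in s] `|` [fset g v | v in s])%fset in
  in_simplex t (realize fS x) /\ in_simplex t (realize gS x).
Proof.
move=> xs t; split; apply: fsubset_trans (in_simplex_realize _ xs) _.
  exact: fsubsetUl.
exact: fsubsetUr.
Qed.

End Pushforward.

Section Functoriality.
Variables (R : realType) (U V W : choiceType).
Variables (J : simplicial_complex U) (K : simplicial_complex V).
Variables (L : simplicial_complex W).

Lemma realize_comp (f : U -> V) (g : V -> W) (fS : simplicial J K f)
    (gS : simplicial K L g) (gfS : simplicial J L (g \o f)) :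
  realize (R := R) gS \o realize (R := R) fS = realize (R := R) gfS.
Proof.
apply/funext => x; apply: coord_inj => w /=.
have xx : in_simplex (finsupp (coord x)) x by exact: fsubset_refl.
rewrite [LHS](push_sum _ _ (in_simplex_realize fS xx)) [RHS](push_sum _ _ xx).
under eq_bigr do rewrite [coord _ _](push_sum _ _ xx).
rewrite (exchange_big_dep (fun u => g (f u) == w))/=; last first.
  by move=> v u /eqP <- /eqP ->.
rewrite big_seq_cond [RHS]big_seq_cond; apply: eq_bigr => u /andP[ux /eqP guw].
rewrite big_mkcond (bigD1_seq (f u)) ?fset_uniq ?in_imfset//=.
rewrite guw !eqxx big1 ?addr0// => v /negPf vfu.
by rewrite [f u == v]eq_sym vfu andbF.
Qed.

Lemma realize_id (idS : simplicial J J id) : realize (R := R) idS = id.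
Proof.
apply/funext => x; apply: coord_inj => w.
(* With [w] adjoined, the sum over the fibre of [id] has exactly one term even when [w] is outside
   the support. *)
have xx : in_simplex (w |` finsupp (coord x))%fset x by exact: fsubsetU1.
by rewrite [LHS](push_sum _ _ xx)
  (fbig_pred1_inj _ _ (fset1U1 _ _) (@inj_id _)).
Qed.

End Functoriality.

(** * Straight-line homotopies between contiguous maps *)

Section ContiguousHomotopy.
Variables (R : realType) (V W : choiceType).
Variables (K : simplicial_complex V) (L : simplicial_complex W).
Variables (f g : V -> W) (fS : simplicial K L f) (gS : simplicial K L g).
Hypothesis fg : contiguous K L f g.
Local Notation "|K|" := (realization R K).
Local Notation "|L|" := (realization R L).

(* The homotopy must be a total function of its time parameter. *)
Definition clip (c : R) : R := Num.max 0 (Num.min 1 c).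

Lemma clip_itv c : 0 <= clip c <= 1.
Proof. by rewrite /clip le_max lexx ge_max ler01 ge_min lexx. Qed.

Lemma clip_id c : 0 <= c <= 1 -> clip c = c.
Proof. by move=> /andP[c0 c1]; rewrite /clip min_r// max_r. Qed.

Lemma clip_lipschitz c d : `|clip c - clip d| <= `|c - d|.
Proof.
have := ler_norm (c - d); have := ler_norm (d - c); rewrite distrC => cd dc.
rewrite /clip ler_norml; case: (leP 1 c) => ?; case: (leP 1 d) => ?.
all: by do 2?[case: (leP 0) => ?]; apply/andP; split; lra.
Qed.

Definition straight_line (p : |K| * R) : |L| :=
  let x := p.1 in
  let xx := fsubset_refl (finsupp (coord x)) in
  SigSub (mem_set (seg_coord_realization (fg (simplex_finsupp x))
    (realize_contiguous fS gS xx).1 (realize_contiguous fS gS xx).2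
    (clip_itv p.2))).

Lemma straight_lineE x c w : coord (straight_line (x, c)) w =
  (1 - clip c) * push f (coord x) w + clip c * push g (coord x) w.
Proof. exact: seg_coordE. Qed.

Lemma in_simplex_straight_line s x c : in_simplex s x ->
  in_simplex ([fset f v | v in s] `|` [fset g v | v in s])%fset
    (straight_line (x, c)).
Proof.
move=> xs; have [fx gx] := realize_contiguous fS gS xs.
by apply: fsubset_trans (finsupp_sub _ _ _) _; rewrite fsubUset; apply/andP.
Qed.

Lemma straight_line_lipschitz s x y c d e w :
  in_simplex s x -> in_simplex s y ->
  (forall v, v \in s -> `|coord x v - coord y v| <= e) ->
  `|coord (straight_line (x, c)) w - coord (straight_line (y, d)) w|
     <= #|` s|%:R * e + `|c - d|.
Proof.
move=> xs ys xye; rewrite !straight_lineE.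
have := push_lipschitz f w xs ys xye; have := push_lipschitz g w xs ys xye.
have /andP[c0 c1] := clip_itv c.
have cd := clip_lipschitz c d.
have fy0 := coord_ge0 (realize fS y) w; have fy1 := coord_le1 (realize fS y) w.
have gy0 := coord_ge0 (realize gS y) w; have gy1 := coord_le1 (realize gS y) w.
rewrite /coord/= -/(coord y) in fy0 fy1 gy0 gy1.
move: (push f _ _) (push f _ _) (push g _ _) (push g _ _) fy0 fy1 gy0 gy1.
move=> fx fy gx gy fy0 fy1 gy0 gy1 gxy fxy.
(* The increment splits into a convex combination of the two increments in space and a time
   increment, whose factor [gy - fy] has absolute value at most 1. *)
rewrite (_ : _ - _ = ((1 - clip c) * (fx - fy) + clip c * (gx - gy)) +
  (clip c - clip d) * (gy - fy)); last by ring.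
apply: le_trans (ler_normD _ _) _; apply: lerD.
  apply: le_trans (ler_normD _ _) _; rewrite !normrM.
  rewrite (ger0_norm c0) ger0_norm ?subr_ge0//.
  rewrite [X in _ <= X](_ : _ = (1 - clip c) * (#|` s|%:R * e) +
    clip c * (#|` s|%:R * e)); last by ring.
  by apply: lerD; rewrite ler_wpM2l ?subr_ge0.
rewrite normrM -[X in _ <= X]mulr1 ler_pM//.
by rewrite ler_norml; lra.
Qed.

(* Tube lemma: the product topology on |K| x [0, 1] is tested on closed simplices
   because the time interval around t0 can be taken compact. *)
Lemma continuous_straight_line : continuous straight_line.
Proof.
move=> [x0 t0] U; rewrite nbhsE => -[O [oO Ox0] OU].
have x0x0 := fsubset_refl (finsupp (coord x0)).
have [e e0 eO] := oO _ (fg (simplex_finsupp x0)) _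
  (in_simplex_straight_line t0 x0x0) Ox0.
(* Over times in [T] the coordinates of the line from [x0] move by at most [e / 2], within the
   margin [e] allowed by [O]. *)
pose T := `[t0 - e / 2, t0 + e / 2]%classic : set R.
pose N : set |K| := [set x | forall t, T t -> O (straight_line (x, t))].
have Nx0 : N x0.
  move=> t; rewrite /T/= in_itv/= => /andP[t1 t2].
  apply: eO (in_simplex_straight_line t x0x0) _ => w _.
  apply: (@le_lt_trans _ _ (#|` finsupp (coord x0)|%:R * 0 + `|t0 - t|)).
    by apply: straight_line_lipschitz => // v _; rewrite subrr normr0.
  rewrite mulr0 add0r; apply: (@le_lt_trans _ _ (e / 2)); last by lra.
  by rewrite ler_norml; lra.
have oN : open N.
  rewrite realization_openE => s Ks x xs Nx.
  pose P (d t : R) := forall y, in_simplex s y ->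
    (forall v, v \in s -> `|coord x v - coord y v| < d) ->
    O (straight_line (y, t)).
  (* Compactness of [T] turns the radii found near each time into a single radius valid for all of
     [T]. *)
  have /compact_near_coveringP/(_ R (0^'+) P _) : compact T by exact: segment_compact.
  case=> [t Tt|].
    have [d d0 dO] := oO _ (fg Ks) _ (in_simplex_straight_line t xs) (Nx t Tt).
    have n0 : 0 < 2 * #|` s|.+1%:R :> R by rewrite mulr_gt0 ?ltr0n.
    (* Half of the margin [d] goes to the change of time, the other half to the change of point. *)
    exists ([set t' | `|t - t'| < d / 2],
            [set r | 0 < r < d / (2 * #|` s|.+1%:R)]) => /=.
      split; first by apply: (@nbhsx_ballx _ _ t (d / 2)); rewrite divr_gt0.
      near=> r; apply/andP; split; first by near: r; exact: nbhs_right_gt.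
      by near: r; apply: nbhs_right_lt; exact: divr_gt0.
    move=> [t' r] /= [tt' /andP[r0 rd]] y ys xy.
    apply: dO (in_simplex_straight_line t' ys) _ => w _.
    have xy' v : v \in s -> `|coord x v - coord y v| <= r by move=> /xy/ltW.
    apply: (le_lt_trans (straight_line_lipschitz _ _ _ xs ys xy')).
    rewrite [ltRHS](splitr d); apply: ler_ltD => //.
    have := ltW rd; rewrite ler_pdivlMr// => rd'.
    rewrite ler_pdivlMr//; apply: le_trans rd'.
    rewrite [leLHS](_ : _ = r * (2 * #|` s|%:R)); last by ring.
    by rewrite ler_pM2l// ler_pM2l// ler_nat.
  move=> d /= d0 dP; exists (d / 2); first exact: divr_gt0.
  move=> y ys xy t Tt; apply: (dP (d / 2)) ys xy => //=.
    by rewrite sub0r normrN gtr0_norm ?divr_gt0// ltr_pdivrMr//; lra.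
  exact: divr_gt0.
exists (N, ball t0 (e / 2)).
  split; last by apply: nbhsx_ballx; exact: divr_gt0.
  exact: open_nbhs_nbhs.
move=> [x t] /= [Nx]; rewrite /ball/= => xt; apply: OU; apply: Nx.
by move: xt; rewrite /T/= in_itv/= ltr_norml => /andP[? ?]; apply/andP; split; lra.
Unshelve. all: by end_near.
Qed.

Lemma contiguous_homotopic :
  homotopic R (realize (R := R) fS) (realize (R := R) gS).
Proof.
exists straight_line; split.
- exact/continuous_subspaceT/continuous_straight_line.
- move=> x; apply: coord_inj => w.
  by rewrite straight_lineE clip_id ?lexx ?ler01// subr0 mul1r mul0r addr0.
- move=> x; apply: coord_inj => w.
  by rewrite straight_lineE clip_id ?lexx ?ler01// subrr mul1r mul0r add0r.
Qed.

End ContiguousHomotopy.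

(** * The length metric *)

(** Cauchy-Schwarz against the constant 1: after doubling, the difference of the two sides is the
    double sum of [(F i - F j) ^+ 2]. *)
Lemma sqr_sum_le (R : realDomainType) (I : Type) (r : seq I) (F : I -> R) :
  (\sum_(i <- r) F i) ^+ 2 <= (size r)%:R * \sum_(i <- r) F i ^+ 2.
Proof.
rewrite -(@ler_pM2l _ 2)// expr2 big_distrlr/=.
have sumE : 2 * ((size r)%:R * \sum_(i <- r) F i ^+ 2) =
    \sum_(i <- r) \sum_(j <- r) (F i ^+ 2 + F j ^+ 2).
  under [RHS]eq_bigr do rewrite big_split/= big_const_seq count_predT iter_addr_0.
  rewrite big_split/= sumrMnl big_const_seq count_predT iter_addr_0.
  by rewrite -mulr2n !mulr_natl.
rewrite sumE mulr_sumr; apply: ler_sum => i _.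
rewrite mulr_sumr; apply: ler_sum => j _.
by rewrite -subr_ge0 (_ : _ - _ = (F i - F j) ^+ 2) ?sqr_ge0//; ring.
Qed.

Section LengthMetric.
Variables (R : realType) (V : choiceType) (K : simplicial_complex V).
Implicit Types (x y z : realization R K) (s : {fset V}).

Lemma simplex_distE s x y : in_simplex s x -> in_simplex s y ->
  simplex_dist x y =
  Num.sqrt (2^-1 * \sum_(v <- s) (coord x v - coord y v) ^+ 2).
Proof.
move=> xs ys; congr (Num.sqrt (_ * _)); apply: big_fset_incl.
  by rewrite fsubUset; apply/andP.
move=> v _; rewrite inE negb_or => /andP[vx vy].
by rewrite /coord !fsfun_dflt// subrr expr0n.
Qed.

(** For coordinates in [0, 1] each squared difference is at most [coord x v + coord y v]; these sum
    to 2, whatever the dimension. *)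
Lemma simplex_dist_le1 s x y : in_simplex s x -> in_simplex s y ->
  simplex_dist x y <= 1.
Proof.
move=> xs ys; rewrite (simplex_distE xs ys) -[leRHS]sqrtr1 ler_wsqrtr//.
rewrite mulrC ler_pdivrMr// mul1r.
apply: (@le_trans _ _ (\sum_(v <- s) (coord x v + coord y v))); last first.
  by rewrite big_split/= !sum_coord.
apply: ler_sum => v _.
have := coord_ge0 x v; have := coord_le1 x v.
by have := coord_ge0 y v; have := coord_le1 y v; nra.
Qed.

Lemma length_dist_ge0 x y : (0 <= length_dist x y)%E.
Proof.
apply/ereal_infP => _ [_ [n [p [_ ->]]] <-]; rewrite lee_fin.
by apply: sumr_ge0 => i _; exact: sqrtr_ge0.
Qed.

Lemma length_dist_le1 s x y : simplex K s -> in_simplex s x -> in_simplex s y ->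
  (length_dist x y <= 1%:E)%E.
Proof.
move=> Ks xs ys; apply: (@le_trans _ _ (simplex_dist x y)%:E).
  apply: ereal_inf_lbound; exists (simplex_dist x y) => //.
  exists 1%N, (fun i => if i is 0%N then x else y); split.
    by split=> // -[|]// _; exists s.
  by rewrite big_ord1.
by rewrite lee_fin (simplex_dist_le1 xs ys).
Qed.

Lemma length_dist_triangle y x z :
  (length_dist x z <= length_dist x y + length_dist y z)%E.
Proof.
have [->|xy_oo] := eqVneq (length_dist x y) +oo%E.
  by rewrite addye ?leey// gt_eqF// (lt_le_trans _ (length_dist_ge0 y z)) ?ltNy0.
have xy_fin : length_dist x y \is a fin_num.
  by rewrite ge0_fin_numE ?length_dist_ge0// lt_neqAle xy_oo leey.
rewrite -leeBlDl//; apply/ereal_infP => _ [l [n [p [pS ->]]] <-].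
rewrite leeBlDl// -leeBlDr//; apply/ereal_infP => _ [k [m [r [rS ->]]] <-].
rewrite leeBlDr// -EFinD; apply: ereal_inf_lbound.
eexists; last by []; exists (m + n)%N.
(* Concatenation of strings: index [m] already belongs to [p], which is consistent since [r m] and
   [p 0] are both [y]. *)
exists (fun i => if (i < m)%N then r i else p (i - m)%N).
have [r0 rm rs] := rS; have [p0 pn ps] := pS; split.
  split.
  - by case: m rm {rS rs} => [|m]//= ry; rewrite p0 -ry.
  - by rewrite ltnNge leq_addr/= addKn.
  move=> i imn; case: (ltnP i m) => im.
    have [s sP] := rs i im; exists s; case: ltnP => // mi.
    have -> : (i.+1 - m = 0)%N by lia.
    by rewrite p0 -rm; have <- : i.+1 = m by lia.
  rewrite ltnNge (leq_trans im)//= subSn//; apply: ps; lia.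
rewrite big_split_ord/=; congr (_ + _); apply: eq_bigr => i _.
  rewrite ltn_ord; case: ltnP => // mi.
  have -> : (i.+1 - m = 0)%N by have := ltn_ord i; lia.
  by rewrite p0 -rm; congr (simplex_dist _ (r _)); have := ltn_ord i; lia.
by rewrite !ltnNge leq_addr/= -addnS leq_addr/= !addKn.
Qed.

End LengthMetric.

Section LipschitzRealization.
Variables (R : realType) (V W : choiceType).
Variables (K : simplicial_complex V) (L : simplicial_complex W).
Variables (f : V -> W) (fS : simplicial K L f) (N : nat).
Hypothesis fN : fibers_bounded N f.
Implicit Types (x y : realization R K) (s : {fset V}).

(* Cauchy-Schwarz on the fibres: collapsing n vertices to one has norm sqrt n on
   the Euclidean space of coordinates, whatever the dimension of the simplex. *)
Lemma simplex_dist_realize s x y : in_simplex s x -> in_simplex s y ->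
  simplex_dist (realize fS x) (realize fS y) <=
  Num.sqrt N.+1%:R * simplex_dist x y.
Proof.
move=> xs ys.
rewrite (simplex_distE (in_simplex_realize fS xs) (in_simplex_realize fS ys)).
rewrite (simplex_distE xs ys) -sqrtrM ?ler0n// ler_wsqrtr//.
rewrite mulrCA ler_pM2l// (partition_big_imfset _ f)/= mulr_sumr.
apply: ler_sum => w _; rewrite [coord _ _](push_sum _ _ xs).
rewrite [coord (realize fS y) _](push_sum _ _ ys) -sumrB.
rewrite -[X in X ^+ 2]big_filter -[X in _ * X]big_filter.
apply: le_trans (sqr_sum_le _ _) _.
rewrite ler_wpM2r//; first by apply: sumr_ge0 => v _; exact: sqr_ge0.
rewrite ler_nat; apply: leqW; apply: (fN (w := w)).
  by rewrite filter_uniq.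
by move=> v; rewrite mem_filter => /andP[/eqP].
Qed.

Lemma length_dist_realize x y :
  (length_dist (realize fS x) (realize fS y) <=
   (Num.sqrt N.+1%:R)%:E * length_dist x y)%E.
Proof.
(* The successor keeps the factor positive for every [N], so it can be moved across the infimum by
   division. *)
have c0 : 0 < Num.sqrt N.+1%:R :> R by rewrite sqrtr_gt0 ltr0n.
rewrite -lee_pdivrMl//.
apply/ereal_infP => _ [_ [n [p [[p0 pn ps] ->]]] <-].
rewrite lee_pdivrMl//; apply: (@le_trans _ _
  (\sum_(i < n) simplex_dist (realize fS (p i)) (realize fS (p i.+1)))%:E).
  apply: ereal_inf_lbound; eexists; last by [].
  exists n, (realize fS \o p); split=> //=; split=> /=; rewrite ?p0 ?pn// => i i_n.
  have [s [Ks pis piSs]] := ps i i_n.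
  exists [fset f v | v in s]%fset.
  by split; [exact: fS|exact: in_simplex_realize|exact: in_simplex_realize].
rewrite -EFinM lee_fin mulr_sumr; apply: ler_sum => i _.
have [s [_ pis piSs]] := ps i (ltn_ord i); exact: simplex_dist_realize pis piSs.
Qed.

End LipschitzRealization.

(** * Simplicial maps with an inverse up to contiguity *)

Lemma simplicial_id (V : choiceType) (K : simplicial_complex V) :
  simplicial K K id.
Proof. by move=> s Ks; rewrite imfset_id. Qed.

Section ContiguousInverse.
Variables (R : realType) (V W : choiceType).
Variables (K : simplicial_complex V) (L : simplicial_complex W).
Variables (f : V -> W) (g : W -> V).
Variables (fS : simplicial K L f) (gS : simplicial L K g).
Hypothesis gf1 : contiguous K K (g \o f) id.

Lemma simplicial_comp : simplicial K K (g \o f).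
Proof.
move=> s /fS/gS; rewrite [X in simplex K X -> _](_ : _ =
  [fset (g \o f) v | v in s]%fset)//.
apply/fsetP => v; apply/imfsetP/imfsetP => -[/= u].
  by move=> /imfsetP[w /= ws ->] ->; exists w.
by move=> us ->; exists (f u) => //; exact: in_imfset.
Qed.

Lemma realize_inverse_homotopic :
  homotopic R (realize (R := R) gS \o realize (R := R) fS) id.
Proof.
rewrite (realize_comp R fS gS simplicial_comp) -(realize_id R (@simplicial_id _ K)).
exact: contiguous_homotopic.
Qed.

Lemma realize_inverse_dist (x : realization R K) :
  (length_dist (realize gS (realize fS x)) x <= 1%:E)%E /\
  (length_dist x (realize gS (realize fS x)) <= 1%:E)%E.
Proof.
have [] := realize_contiguous simplicial_comp (@simplicial_id _ K)
  (fsubset_refl (finsupp (coord x))).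
rewrite -(realize_comp R fS gS) realize_id/= => gfx xx.
by split; apply: length_dist_le1 (gf1 (simplex_finsupp x)) _ _.
Qed.

End ContiguousInverse.

Section InverseRealizations.
Variables (R : realType) (V W : choiceType).
Variables (K : simplicial_complex V) (L : simplicial_complex W).
Variables (f : V -> W) (g : W -> V).
Variables (fS : simplicial K L f) (gS : simplicial L K g).
Hypotheses (gf1 : contiguous K K (g \o f) id).
Hypotheses (fg1 : contiguous L L (f \o g) id).

Lemma realize_homotopy_equivalence :
  homotopy_equivalence R (realize (R := R) fS).
Proof.
split; first exact: continuous_realize.
exists (realize (R := R) gS).
by split; [exact: continuous_realize|exact: realize_inverse_homotopic..].
Qed.

Lemma realize_quasi_isometry (M N : nat) :
  fibers_bounded M f -> fibers_bounded N g ->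
  quasi_isometry (@length_dist R _ K) (@length_dist R _ L)
    (realize (R := R) fS).
Proof.
move=> fM gN; pose Rf := realize (R := R) fS; pose Rg := realize (R := R) gS.
pose a : R := Num.sqrt M.+1%:R; pose b : R := Num.sqrt N.+1%:R.
have a1 : 1 <= a by rewrite -sqrtr1 ler_wsqrtr// ler1n.
have b1 : 1 <= b by rewrite -sqrtr1 ler_wsqrtr// ler1n.
have Rf_le x y : (length_dist (Rf x) (Rf y) <= a%:E * length_dist x y)%E.
  exact: length_dist_realize.
(* The route from [x] to [y] through [Rg (Rf x)] and [Rg (Rf y)] costs at most 1 at each end. *)
have Rf_ge x y : (length_dist x y <= b%:E * length_dist (Rf x) (Rf y) + 2%:E)%E.
  have [_ x1] := realize_inverse_dist fS gS gf1 x.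
  have [y1 _] := realize_inverse_dist fS gS gf1 y.
  apply: le_trans (length_dist_triangle (Rg (Rf x)) _ _) _.
  apply: le_trans (leeD x1 (length_dist_triangle (Rg (Rf y)) _ _)) _.
  rewrite addeCA; apply: leeD; first exact: length_dist_realize.
  by apply: le_trans (leeD (lexx _) y1) _; rewrite -EFinD lee_fin; lra.
have ab1 : 1 <= a * b by nra.
(* Since [a] and [b] are at least 1, [a * b] dominates both factors, and dividing [b * r' + 2] by it
   leaves at most [r' + 2]. *)
exists (a * b), 2; split=> //.
split=> [x y|x y xy_oo|y].
- split=> oo.
    have := Rf_ge x y; rewrite oo.
    have := length_dist_ge0 (Rf x) (Rf y).
    by case: (length_dist (Rf x) (Rf y)) => //= r _; rewrite -EFinM -EFinD.
  have := Rf_le x y; rewrite oo.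
  have := length_dist_ge0 x y.
  by case: (length_dist x y) => //= r _; rewrite -EFinM.
- have := Rf_le x y; have := Rf_ge x y.
  have := length_dist_ge0 x y; have := length_dist_ge0 (Rf x) (Rf y).
  move: xy_oo; case: (length_dist x y) => // r _.
  case: (length_dist (Rf x) (Rf y)) => [r'||]//.
  rewrite -?EFinM -?EFinD -?EFinB !lee_fin => r'0 r0 rr' r'r; split.
    rewrite lerBlDr mulrC ler_pdivrMr; last by lra.
    apply: le_trans rr' _.
    rewrite [leRHS](_ : _ = a * (b * r') + 2 * (a * b)); last by ring.
    by apply: lerD; [rewrite ler_peMl ?mulr_ge0//; lra|lra].
  apply: le_trans r'r _.
  have ab : a * r <= a * b * r by rewrite ler_wpM2r// ler_peMr//; lra.
  by lra.
- exists (Rg y); have [_ y1] := realize_inverse_dist gS fS fg1 y.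
  by apply: le_trans y1 _; rewrite lee_fin; lra.
Qed.

End InverseRealizations.

Theorem theorem1p4 (R : realType) (X Y : group_pair) (q : X -> Y)
    (hq : pair_quasi_isometry R q) :
  [/\ forall qd : coset X -> coset Y, induced_map R q qd ->
        exists qdS : simplicial (coset_complex X) (coset_complex Y) qd,
          homotopy_equivalence R (realize (R := R) qdS),
      forall qd1 qd2 : coset X -> coset Y,
        induced_map R q qd1 -> induced_map R q qd2 ->
        forall (qd1S : simplicial (coset_complex X) (coset_complex Y) qd1)
               (qd2S : simplicial (coset_complex X) (coset_complex Y) qd2),
          homotopic R (realize (R := R) qd1S) (realize (R := R) qd2S) &
      forall qd : coset X -> coset Y, induced_map R q qd ->
        forall qdS : simplicial (coset_complex X) (coset_complex Y) qd,
          quasi_isometry (@length_dist R _ (coset_complex X))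
            (@length_dist R _ (coset_complex Y)) (realize (R := R) qdS)].
Proof.
have qC : coarse_embedding q.
  by have [A [B [M /quasi_isometry_coarse[]]]] := hq.
have [psi [g [psiC psig psiq qpsi]]] := coarse_inverse hq.
have gS := tracks_simplicial psiC psig.
(* The same [g] inverts every induced map up to contiguity, since both composites track maps close
   to the identity. *)
have inverse qd : tracks q qd ->
    contiguous (coset_complex X) (coset_complex X) (g \o qd) id /\
    contiguous (coset_complex Y) (coset_complex Y) (qd \o g) id.
  move=> qqd; split.
    apply: contiguous_close psiq (tracks_comp psiC qqd psig) (tracks_id X).
    exact: coarse_embedding_comp.
  apply: contiguous_close qpsi (tracks_comp qC psig qqd) (tracks_id Y).
  exact: coarse_embedding_comp.
split=> [qd /induced_map_tracks qqd|qd1 qd2|qd /induced_map_tracks qqd qdS].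
- have [gf1 fg1] := inverse _ qqd.
  exists (tracks_simplicial qC qqd).
  exact: (realize_homotopy_equivalence R _ gS gf1 fg1).
- move=> /induced_map_tracks q1 /induced_map_tracks q2 qd1S qd2S.
  (* Both induced maps track the same [q], which is at distance 0 from itself, so they are
     contiguous. *)
  apply: contiguous_homotopic; apply: contiguous_close qC _ q1 q2.
  by exists 0%N => x; exact: word_nearxx.
- have [gf1 fg1] := inverse _ qqd.
  have [M qdM] := tracks_fibers_bounded qC qqd.
  have [N gN] := tracks_fibers_bounded psiC psig.
  exact: (realize_quasi_isometry R qdS gS gf1 fg1 qdM gN).
Qed.
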